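(* Let $(M,E,g_M)$ be a quaternionic Kähler manifold, $(N,g_N)$ a Riemannian manifold, and $F:M\to N$ an $h$-conformal semi-invariant submersion with $h$-conformal semi-invariant basis $\{J_1,J_2,J_3\}$ and associated decomposition $\ker F_*=\mathcal{D}_1\oplus\mathcal{D}_2$. Then: (i) The distribution $\mathcal{D}_2$ is always integrable. (ii) The following conditions are equivalent: (a) the distribution $\mathcal{D}_1$ is integrable; (b) $(\nabla F_* )(Z,J_1Y)-(\nabla F_* )(Y,J_1Z)\in\Gamma(F_*\mu^{J_1})$ for all $Y,Z\in\Gamma(\mathcal{D}_1)$; (c) $(\nabla F_* )(Z,J_2Y)-(\nabla F_* )(Y,J_2Z)\in\Gamma(F_*\mu^{J_2})$ for all $Y,Z\in\Gamma(\mathcal{D}_1)$; (d) $(\nabla F_* )(Z,J_3Y)-(\nabla F_* )(Y,J_3Z)\in\Gamma(F_*\mu^{J_3})$ for all $Y,Z\in\Gamma(\mathcal{D}_1)$.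
   Context: All objects are smooth; $\Gamma(\cdot)$ denotes sections. Indices $\alpha\in\{1,2,3\}$ are taken modulo $3$. An almost quaternionic Hermitian manifold $(M,E,g_M)$ is a Riemannian manifold of dimension divisible by $4$ with a rank $3$ subbundle $E\subset\operatorname{End}(TM)$ having near each point a local basis $\{J_1,J_2,J_3\}$ of sections (a quaternionic Hermitian basis) with $J_\alpha^2=-\mathrm{id}$, $J_\alpha J_{\alpha+1}=-J_{\alpha+1}J_\alpha=J_{\alpha+2}$, $g_M(J_\alpha X,J_\alpha Y)=g_M(X,Y)$. It is quaternionic Kähler if there are locally defined $1$-forms $\omega_1,\omega_2,\omega_3$ with $\nabla_XJ_\alpha=\omega_{\alpha+2}(X)J_{\alpha+1}-\omega_{\alpha+1}(X)J_{\alpha+2}$, $\nabla$ the Levi-Civita connection of $g_M$. An $h$-conformal (horizontally conformal) submersion $F:(M,g_M)\to(N,g_N)$ ($\dim M>\dim N$) with dilation $\lambda:M\to(0,\infty)$ is a surjective map of maximal rank with $g_N(F_*V,F_*W)=\lambda^2g_M(V,W)$ for $V,W\in(\ker F_* )^\perp$. It is an $h$-conformal semi-invariant submersion if near each point there is a quaternionic Hermitian basis $\{J_1,J_2,J_3\}$ (an $h$-conformal semi-invariant basis) and a distribution $\mathcal{D}_1\subset\ker F_*$ such that, with $\mathcal{D}_2$ the orthogonal complement of $\mathcal{D}_1$ in $\ker F_*$, $R(\mathcal{D}_1)=\mathcal{D}_1$ and $R(\mathcal{D}_2)\subset(\ker F_* )^\perp$ for every $R\in\{J_1,J_2,J_3\}$.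 Statements involving the $J_\alpha$ are understood on the domain of the basis. $\mu^{J_\alpha}$ is the orthogonal complement of $J_\alpha\mathcal{D}_2$ in $(\ker F_* )^\perp$. The second fundamental form of $F$ is $(\nabla F_* )(X,Y)=\nabla^F_XF_*Y-F_*(\nabla_XY)$, with $\nabla^F$ the pullback to $F^{-1}TN$ of the Levi-Civita connection of $g_N$. *)

(* Defs.v *)
(* All fields on a manifold M (vector fields, endomorphism fields, forms,
   metrics, ...) are total functions on M, and are considered on an explicit
   open set U; their values off U are irrelevant. *)
From HB Require Import structures.
From mathcomp Require Import all_boot all_order all_algebra.
From mathcomp Require Import all_classical all_reals all_analysis.

Set Implicit Arguments.
Unset Strict Implicit.
Unset Printing Implicit Defensive.

Import Order.TTheory GRing.Theory Num.Theory.
Import numFieldNormedType.Exports.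

Local Open Scope classical_set_scope.
Local Open Scope ring_scope.

Fixpoint Ck (R : realType) (m k : nat) (A : set 'rV[R]_m)
    (f : 'rV[R]_m -> R) : Prop :=
  {in A, continuous f} /\
  (if k is k'.+1 then
     forall i : 'I_m,
       (forall x, A x -> derivable f x (delta_mx 0 i)) /\
       Ck k' A (fun x => 'D_(delta_mx 0 i) f x)
   else True).

Definition Cinfty (R : realType) (m : nat) (A : set 'rV[R]_m)
    (f : 'rV[R]_m -> R) : Prop := forall k, Ck k A f.

Record chart (R : realType) (M : topologicalType) (m : nat) := Chart {
  cdom : set M;
  cmap :> M -> 'rV[R]_m;
  cinv : 'rV[R]_m -> M;
  cdom_open : open cdom;
  cimg_open : open (cmap @` cdom);
  cmapK : {in cdom, cancel cmap cinv};
  cmap_continuous : {in cdom, continuous cmap};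
  cinv_continuous : {in cmap @` cdom, continuous cinv} }.

Record manifold (R : realType) (m : nat) := Manifold {
  carrier :> topologicalType;
  atlas : set (chart R carrier m);
  manifold_hausdorff : hausdorff_space carrier;
  manifold_second_countable : @second_countable carrier;
  atlas_cover : forall p : carrier, exists2 c, atlas c & cdom c p;
  atlas_smooth : forall c d, atlas c -> atlas d -> forall j : 'I_m,
    Cinfty (c @` (cdom c `&` cdom d)) (fun x => d (cinv c x) 0 j) }.

(* Tangent vectors are represented by their action on germs of functions. *)
Notation tvec R M := ((M -> R) -> R) (only parsing).

Section Manifold.
Context {R : realType} {m : nat} {M : manifold R m}.

Definition smooth_on (U : set M) (f : M -> R) : Prop :=
  forall c, atlas c -> Cinfty (c @` (U `&` cdom c)) (f \o cinv c).

Definition smooth_near (p : M) (f : M -> R) : Prop :=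
  exists U : set M, [/\ open U, U p & smooth_on U f].

(* To make equality of tangent vectors at p equality of functionals on M -> R,
   they are set to 0 on the functions that are not smooth near p. *)
Definition on_germs (p : M) (d : tvec R M) : tvec R M :=
  fun f => if `[< smooth_near p f >] then d f else 0.

Definition tangent (p : M) : set (tvec R M) :=
  [set d | exists (c : chart R M m) (v : 'rV[R]_m),
     [/\ atlas c, cdom c p &
         d = on_germs p (fun f => 'D_v (f \o cinv c) (c p))]].

End Manifold.

Section Maps.
Context {R : realType} {m n : nat} {M : manifold R m} {N : manifold R n}.
Implicit Types (F : M -> N) (p : M) (U : set M).

Definition smooth_map F : Prop :=
  continuous F /\
  forall d, atlas d -> forall j : 'I_n,
    smooth_on (F @^-1` cdom d) (fun p => d (F p) 0 j).

Definition tangent_map F p (v : tvec R M) : tvec R N :=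
  on_germs (F p) (fun f => v (f \o F)).

(* Sections over U of the pullback bundle F^{-1}TN.  For F = id these are the
   smooth vector fields on U. *)
Definition section_along F U (s : M -> tvec R N) : Prop :=
  (forall p, U p -> tangent (F p) (s p)) /\
  (forall (W : set N) (f : N -> R), open W -> smooth_on W f ->
     smooth_on (U `&` F @^-1` W) (fun p => s p f)).

End Maps.

Section Connections.
Context {R : realType} {m n : nat} {M : manifold R m} {N : manifold R n}.
Implicit Types (p : M) (U : set M).

Definition vector_field U (X : M -> tvec R M) : Prop :=
  section_along id U X.

Definition lie_bracket (X Y : M -> tvec R M) (p : M) : tvec R M :=
  on_germs p (fun f => X p (fun q => Y q f) - Y p (fun q => X q f)).

Definition linear_on (V W : lmodType R) (A : set V) (f : V -> W) : Prop :=
  forall (a : R) u v, A u -> A v -> f (a *: u + v) = a *: f u + f v.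

(* Linear connections on F^{-1}TN; D p v s is the derivative at p in the
   direction v of the local section s.  [connection_local] makes D act on
   sections over arbitrary open sets, compatibly with restriction. *)
Record connection_along (F : M -> N)
    (D : M -> tvec R M -> (M -> tvec R N) -> tvec R N) :
    Prop := ConnectionAlong {
  connection_local : forall U s s' p v, open U -> U p -> tangent p v ->
    section_along F U s -> {in U, s =1 s'} -> D p v s = D p v s';
  connection_tangent : forall U s p v, open U -> U p -> tangent p v ->
    section_along F U s -> tangent (F p) (D p v s);
  connection_linear : forall U s p, open U -> U p -> section_along F U s ->
    linear_on (tangent p) (fun v => D p v s);
  connection_add : forall U s t p v, open U -> U p -> tangent p v ->
    section_along F U s -> section_along F U t ->
    D p v (fun q => s q + t q) = D p v s + D p v t;
  connection_leibniz : forall U f s p v, open U -> U p -> tangent p v ->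
    smooth_on U f -> section_along F U s ->
    D p v (fun q => f q *: s q) = v f *: s p + f p *: D p v s;
  connection_smooth : forall U X s, open U ->
    vector_field U X -> section_along F U s ->
    section_along F U (fun p => D p (X p) s) }.

Record riemannian_metric (g : M -> tvec R M -> tvec R M -> R) :
    Prop := RiemannianMetric {
  metric_linear : forall p u, tangent p u ->
    linear_on (tangent p) (g p u : _ -> R^o);
  metric_sym : forall p u v, tangent p u -> tangent p v -> g p u v = g p v u;
  metric_pos : forall p u, tangent p u -> u != 0 -> 0 < g p u u;
  metric_smooth : forall U X Y, open U -> vector_field U X ->
    vector_field U Y -> smooth_on U (fun p => g p (X p) (Y p)) }.

Definition smooth_endo U (A : M -> tvec R M -> tvec R M) : Prop :=
  (forall p, U p ->
     linear_on (tangent p) (A p) /\ A p @` tangent p `<=` tangent p) /\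
  (forall V X, open V -> V `<=` U -> vector_field V X ->
     vector_field V (fun p => A p (X p))).

Definition one_form U (w : M -> tvec R M -> R) : Prop :=
  (forall p, U p -> linear_on (tangent p) (w p : _ -> R^o)) /\
  (forall V X, open V -> V `<=` U -> vector_field V X ->
     smooth_on V (fun p => w p (X p))).

(* Smooth subbundles of TM over U, given by local frames; the rank k is only
   locally constant. *)
Definition smooth_distribution U (D : M -> set (tvec R M)) : Prop :=
  forall p, U p -> exists (V : set M) (k : nat)
      (X : 'I_k -> M -> tvec R M),
    [/\ open V, V p, V `<=` U & (forall i, vector_field V (X i))] /\
    forall q, V q ->
      (forall a : 'I_k -> R, \sum_i a i *: X i q = 0 -> forall i, a i = 0) /\
      D q = [set v | exists a : 'I_k -> R, v = \sum_i a i *: X i q].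

Definition section_of U (D : M -> set (tvec R M))
    (X : M -> tvec R M) : Prop :=
  vector_field U X /\ forall p, U p -> D p (X p).

(* Integrability in the sense of Frobenius: the sections are closed under the
   Lie bracket. *)
Definition integrable_distr U (D : M -> set (tvec R M)) : Prop :=
  forall X Y, section_of U D X -> section_of U D Y ->
    section_of U D (lie_bracket X Y).

Definition orth_in (g : M -> tvec R M -> tvec R M -> R) (p : M)
    (A B : set (tvec R M)) : set (tvec R M) :=
  [set v | A v /\ forall w, B w -> g p v w = 0].

End Connections.

Section Quaternionic.
Context {R : realType} {m : nat} {M : manifold R m}.
Variable g : M -> tvec R M -> tvec R M -> R.

Record levi_civita
    (D : M -> tvec R M -> (M -> tvec R M) -> tvec R M) :
    Prop := LeviCivita {
  lc_connection : connection_along id D;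
  lc_torsion_free : forall U X Y p, open U -> U p ->
    vector_field U X -> vector_field U Y ->
    D p (X p) Y - D p (Y p) X = lie_bracket X Y p;
  lc_metric : forall U X Y p v, open U -> U p -> tangent p v ->
    vector_field U X -> vector_field U Y ->
    v (fun q => g q (X q) (Y q)) = g p (D p v X) (Y p) + g p (X p) (D p v Y) }.

(* The indices 1, 2, 3 modulo 3 are the elements 1, 2, 3 = 0 of 'Z_3. *)
Record quaternionic_hermitian_basis
    (E : M -> set (tvec R M -> tvec R M)) (U : set M)
    (J : 'Z_3 -> M -> tvec R M -> tvec R M) : Prop :=
  QuaternionicHermitianBasis {
  qh_open : open U;
  qh_smooth : forall al, smooth_endo U (J al);
  qh_sqr : forall al p v, U p -> tangent p v -> J al p (J al p v) = - v;
  qh_anticomm : forall al p v, U p -> tangent p v ->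
    J al p (J (al + 1) p v) = - J (al + 1) p (J al p v);
  qh_mul : forall al p v, U p -> tangent p v ->
    J al p (J (al + 1) p v) = J (al + 2) p v;
  qh_isometry : forall al p u v, U p -> tangent p u -> tangent p v ->
    g p (J al p u) (J al p v) = g p u v;
  (* E p is a set of endomorphisms of tangent p: only their restrictions to
     tangent p matter. *)
  qh_span : forall p, U p -> E p = [set A | exists a : 'Z_3 -> R,
    forall v, tangent p v -> A v = \sum_al a al *: J al p v] }.

Definition almost_quaternionic_hermitian
    (E : M -> set (tvec R M -> tvec R M)) : Prop :=
  [/\ (4 %| m)%N, riemannian_metric g &
      forall p, exists U J, U p /\ quaternionic_hermitian_basis E U J].

Definition quaternionic_kaehler
    (E : M -> set (tvec R M -> tvec R M))
    (D : M -> tvec R M -> (M -> tvec R M) -> tvec R M) :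
    Prop :=
  almost_quaternionic_hermitian E /\
  forall p, exists U J (w : 'Z_3 -> M -> tvec R M -> R),
    [/\ U p, quaternionic_hermitian_basis E U J,
        forall al, one_form U (w al) &
        forall V Y q v al, open V -> V `<=` U -> vector_field V Y -> V q ->
          tangent q v ->
          D q v (fun x => J al x (Y x)) - J al q (D q v Y) =
            w (al + 2) q v *: J (al + 1) q (Y q)
            - w (al + 1) q v *: J (al + 2) q (Y q)].

End Quaternionic.

Section Submersions.
Context {R : realType} {m n : nat} {M : manifold R m} {N : manifold R n}.
Variable gM : M -> tvec R M -> tvec R M -> R.
Variable gN : N -> tvec R N -> tvec R N -> R.
Variable F : M -> N.

Definition vertical (p : M) : set (tvec R M) :=
  [set v | tangent p v /\ tangent_map F p v = 0].

Definition horizontal (p : M) : set (tvec R M) :=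
  orth_in gM p (tangent p) (vertical p).

Record h_conformal_submersion (lambda : M -> R) : Prop := HConformalSubmersion {
  hc_dim : (n < m)%N;
  hc_smooth : smooth_map F;
  hc_surj : forall y, exists x, F x = y;
  hc_rank : forall p, tangent_map F p @` tangent p = tangent (F p);
  hc_dilation_smooth : smooth_on setT lambda;
  hc_dilation_pos : forall p, 0 < lambda p;
  hc_conformal : forall p v w, horizontal p v -> horizontal p w ->
    gN (F p) (tangent_map F p v) (tangent_map F p w) =
      lambda p ^+ 2 * gM p v w }.

Definition D2_of (D1 : M -> set (tvec R M)) (p : M) :
    set (tvec R M) := orth_in gM p (vertical p) (D1 p).

Record semi_invariant_basis
    (E : M -> set (tvec R M -> tvec R M)) (U : set M)
    (J : 'Z_3 -> M -> tvec R M -> tvec R M)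
    (D1 : M -> set (tvec R M)) : Prop := SemiInvariantBasis {
  si_basis : quaternionic_hermitian_basis gM E U J;
  si_distr : smooth_distribution U D1;
  si_vertical : forall p, U p -> D1 p `<=` vertical p;
  si_D1 : forall al p, U p -> J al p @` D1 p = D1 p;
  si_D2 : forall al p, U p -> J al p @` D2_of D1 p `<=` horizontal p }.

Definition h_conformal_semi_invariant_submersion
    (E : M -> set (tvec R M -> tvec R M)) (lambda : M -> R) :
    Prop :=
  h_conformal_submersion lambda /\
  forall p, exists U J D1, U p /\ semi_invariant_basis E U J D1.

Definition mu_of (J : M -> tvec R M -> tvec R M)
    (D1 : M -> set (tvec R M)) (p : M) : set (tvec R M) :=
  orth_in gM p (horizontal p) (J p @` D2_of D1 p).

Definition push_field (X : M -> tvec R M) : M -> tvec R N :=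
  fun p => tangent_map F p (X p).

(* DF is the pullback to F^{-1}TN of the connection DN on TN. *)
Definition pullback_connection
    (DN : N -> tvec R N -> (N -> tvec R N) -> tvec R N)
    (DF : M -> tvec R M -> (M -> tvec R N) -> tvec R N) :
    Prop :=
  connection_along F DF /\
  forall (W : set N) V p v, open W -> vector_field W V -> W (F p) ->
    tangent p v -> DF p v (V \o F) = DN (F p) (tangent_map F p v) V.

Definition second_fundamental_form
    (DM : M -> tvec R M -> (M -> tvec R M) -> tvec R M)
    (DF : M -> tvec R M -> (M -> tvec R N) -> tvec R N)
    (X Y : M -> tvec R M) (p : M) : tvec R N :=
  DF p (X p) (push_field Y) - tangent_map F p (DM p (X p) Y).

(* (nabla F_* )(Z, J Y) - (nabla F_* )(Y, J Z) is in Gamma(F_* mu^J) for all Y, Z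
   in Gamma(D1), over U. *)
Definition skew_form_in_mu (U : set M) (J : M -> tvec R M -> tvec R M)
    (D1 : M -> set (tvec R M))
    (DM : M -> tvec R M -> (M -> tvec R M) -> tvec R M)
    (DF : M -> tvec R M -> (M -> tvec R N) -> tvec R N) : Prop :=
  forall (Y Z : M -> tvec R M) (s : M -> tvec R N),
    section_of U D1 Y -> section_of U D1 Z ->
    s = (fun p => second_fundamental_form DM DF Z (fun q => J q (Y q)) p
                  - second_fundamental_form DM DF Y (fun q => J q (Z q)) p) ->
    section_along F U s /\
    forall p, U p -> (tangent_map F p @` mu_of J D1 p) (s p).

End Submersions.

(* Main.v *)
(* Both parts rest on one consequence of the quaternionic Kaehler condition:
   (nabla_v J_al) W lies in the span of the J_be W.

   For V, W in D2, T vertical and any direction v, g(J_al W, T) = 0 gives, upon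
   differentiation, g(nabla_v W, J_al T) = g(J_al W, nabla_v T).  Taking X in
   D1, and using that [V, X] is vertical and J_al W horizontal,
     g(nabla_V W, J_al X) = g(J_al W, nabla_V X) = g(J_al W, nabla_X V)
                          = g(nabla_X W, J_al V),
   and the first three terms with V and W exchanged show that the last one is
   g(nabla_W V, J_al X).  So [V, W] is orthogonal to J_al D1 = D1.

   For Y, Z in D1, the fields J_al Y and J_al Z are vertical and D1 is invariant
   under all J_be, so the difference of second fundamental forms equals
   F_*(J_al [Y, Z]) = F_*(J_al u), with u the D2-component of [Y, Z].  As F_* is
   injective on horizontal vectors and J_al u is orthogonal to mu^(J_al), this
   lies in F_* mu^(J_al) only if u = 0. *)
Require Import Defs.
From HB Require Import structures.
From mathcomp Require Import all_boot all_order all_algebra.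
From mathcomp Require Import all_classical all_reals all_analysis.
From mathcomp Require Import ring lra.

Set Implicit Arguments.
Unset Strict Implicit.
Unset Printing Implicit Defensive.

Import Order.TTheory GRing.Theory Num.Theory.
Import numFieldNormedType.Exports.

Local Open Scope classical_set_scope.
Local Open Scope ring_scope.

(** * Functions of class C^k on open sets of R^m; C^1 implies differentiable *)

Section Calculus.
Context {R : realType} {m : nat}.
Implicit Types (A : set 'rV[R]_m) (f g : 'rV[R]_m -> R).

Lemma near_eq_continuous (T : topologicalType) (f g : T -> R) (x : T) :
  {near x, f =1 g} -> {for x, continuous f} -> {for x, continuous g}.
Proof.
move=> fg fx; have fgx : f x = g x := nbhs_singleton fg.
rewrite /prop_for /continuous_at -fgx.
apply: cvg_trans fx; apply: near_eq_cvg.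
by apply: filterS fg => y /esym.
Qed.

Lemma Ck_subset k A B f : B `<=` A -> Ck k A f -> Ck k B f.
Proof.
elim: k f => [|k IH] f BA [fc fd]; split => //.
- by move=> x /set_mem /BA /mem_set /fc.
- by move=> x /set_mem /BA /mem_set /fc.
- by move=> i; have [dfi Ckf] := fd i; split => [x /BA /dfi //|]; exact: IH.
Qed.

Lemma open_near_eq A f g x :
  open A -> A x -> {in A, f =1 g} -> {near x, f =1 g}.
Proof.
move=> oA Ax fg; near=> y; apply: fg; apply: mem_set; near: y.
exact: open_nbhs_nbhs.
Unshelve. all: by end_near. Qed.

Lemma eq_in_Ck k A f g : open A -> {in A, f =1 g} -> Ck k A f -> Ck k A g.
Proof.
elim: k f g => [|k IH] f g oA fg [fc fd]; split => //.
- move=> x xA; apply: near_eq_continuous (fc _ xA).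
  by apply: open_near_eq fg => //; exact: set_mem.
- move=> x xA; apply: near_eq_continuous (fc _ xA).
  by apply: open_near_eq fg => //; exact: set_mem.
- move=> i; have [dfi Ckf] := fd i; split => [x Ax|].
    by apply: near_eq_derivable (dfi _ Ax); exact: open_near_eq fg.
  apply: IH Ckf => // x /set_mem Ax.
  by apply: near_eq_derive; exact: open_near_eq fg.
Qed.

Lemma Ck_le k A f : Ck k.+1 A f -> Ck k A f.
Proof.
elim: k f => [|k IH] f [fc fd]; split => // i.
by have [dfi Ckf] := fd i; split => //; exact: IH.
Qed.

Lemma Ck_cst k A (a : R) : Ck k A (cst a).
Proof.
elim: k a => [|k IH] a; split => //; [exact: (in1W (@cst_continuous _ _ _))..|].
move=> i; split => [x _|]; first exact: derivable_cst.
rewrite (_ : (fun _ => _) = cst 0); first exact: IH.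
by apply/funext => x; rewrite derive_cst.
Qed.

Lemma CkD k A f g : open A -> Ck k A f -> Ck k A g -> Ck k A (f + g).
Proof.
elim: k f g => [|k IH] f g oA [fc fd] [gc gd]; split => //.
- by move=> x xA; apply: continuousD; [exact: fc|exact: gc].
- by move=> x xA; apply: continuousD; [exact: fc|exact: gc].
- move=> i; have [dfi Ckf] := fd i; have [dgi Ckg] := gd i; split => [x Ax|].
    by apply: derivableD; [exact: dfi|exact: dgi].
  apply: eq_in_Ck (IH _ _ oA Ckf Ckg) => // x /set_mem Ax.
  by rewrite deriveD //; [exact: dfi|exact: dgi].
Qed.

Lemma CkM k A f g : open A -> Ck k A f -> Ck k A g -> Ck k A (f * g).
Proof.
elim: k f g => [|k IH] f g oA Cf Cg.
  split => // x xA; apply: continuousM; [exact: Cf.1|exact: Cg.1].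
have [fc fd] := Cf; have [gc gd] := Cg; split => [x xA|i].
  by apply: continuousM; [exact: fc|exact: gc].
have [dfi Ckf] := fd i; have [dgi Ckg] := gd i; split => [x Ax|].
  by apply: derivableM; [exact: dfi|exact: dgi].
(* In each Leibniz term one factor is [f] or [g] itself, which [Ck_le] lowers to the class [k] of
   the derivative beside it. *)
apply: eq_in_Ck (CkD oA (IH _ _ oA (Ck_le Cf) Ckg) (IH _ _ oA (Ck_le Cg) Ckf)).
  exact: oA.
by move=> x /set_mem Ax; rewrite deriveM //; [exact: dfi|exact: dgi].
Qed.

Lemma is_derive_line f (y v : 'rV[R]_m) (s : R) : derivable f (y + s *: v) v ->
  is_derive s 1 (fun t => f (y + t *: v)) ('D_v f (y + s *: v)).
Proof.
have E : (fun h : R => h^-1 *: (((fun t => f (y + t *: v)) \o shift s) (h *: 1)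
     - f (y + s *: v))) =
   (fun h : R => h^-1 *: ((f \o shift (y + s *: v)) (h *: v)
     - f (y + s *: v))).
  by apply/funext => h /=; rewrite [h *: 1]mulr1 scalerDl addrCA.
by move=> fd; split; rewrite /derivable /derive /= E.
Qed.

(** Mean value inequality for [phi s - l * s] on the segment between 0 and [a], where [a] may have
    either sign. *)
Lemma le_increment (phi dphi : R -> R) (l e a : R) :
  (forall s : R, `|s| <= `|a| -> is_derive s 1 phi (dphi s)) ->
  (forall s : R, `|s| <= `|a| -> `|dphi s - l| <= e) ->
  `|phi a - phi 0 - l * a| <= e * `|a|.
Proof.
move=> dp dpe.
(* [[u, v]] is the segment between 0 and [a] with its ends in increasing order; swapping the ends
   does not change the absolute value. *)
have [u [v [uv [absuv uva]]]] : exists u v : R, u <= v /\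
    (forall s, s \in `[u, v]%R -> `|s| <= `|a|) /\
    (v - u = `|a| /\ `|phi a - phi 0 - l * a| =
                    `|phi v - phi u - l * (v - u)|).
  have [a0|a0] := leP 0 a.
    exists 0, a; split => //; split; last by rewrite subr0 ger0_norm.
    by move=> s; rewrite in_itv /= => /andP[s0 sa]; rewrite !ger0_norm.
  exists a, 0; split; first exact: ltW.
  split; last first.
    split; first by rewrite sub0r ltr0_norm.
    by rewrite -[in LHS]normrN; congr `|_|; rewrite sub0r !opprD !opprK mulrN
      opprK [- phi a + _]addrC.
  by move=> s; rewrite in_itv /= => /andP[s0 sa]; rewrite !ler0_norm ?lerN2 // ltW.
case: uva => vu ->.
have [|||c cuv ->] := @MVT_segment R phi dphi u v; first exact: uv.
- by move=> s /subset_itv_oo_cc suv; apply: dp; exact: absuv.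
- apply: derivable_within_continuous => s /absuv /dp ds; exact: ex_derive.
by rewrite -mulrBl normrM vu normr_id ler_wpM2r // dpe // absuv.
Qed.

(** The points [x + trunc k h] form a path from [x] to [x + h] that changes one coordinate at a
    time. *)
Let trunc k (h : 'rV[R]_m) : 'rV[R]_m := \row_j (if (j < k)%N then h 0 j else 0).

Let truncS k (h : 'rV[R]_m) (km : (k < m)%N) :
  trunc k.+1 h = trunc k h + h 0 (Ordinal km) *: delta_mx 0 (Ordinal km).
Proof.
apply/rowP => j; rewrite !mxE eqxx /= ltnS leq_eqVlt -(inj_eq val_inj) /=.
case: eqVneq => [jk|_] /=; last by rewrite mulr0 addr0.
rewrite jk ltnn mulr1 add0r; congr (h 0 _); exact: val_inj.
Qed.

Let le_coord (h : 'rV[R]_m) j : `|h 0 j| <= `|h|.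
Proof.
rewrite [leRHS]/Num.Def.normr /= mx_normrE.
exact: (le_bigmax _ (fun i : 'I_1 * 'I_m => `|h i.1 i.2|) (0, j)).
Qed.

Let le_norm (h d : 'rV[R]_m) :
  (forall j, `|d 0 j| <= `|h 0 j|) -> `|d| <= `|h|.
Proof.
move=> dh; rewrite [leLHS]/Num.Def.normr /= mx_normrE.
apply: bigmax_le => // -[i j] _ /=; rewrite (ord1 i).
exact: le_trans (dh j) (le_coord h j).
Qed.

(** Telescoping along the path [x + trunc k h]: by the mean value inequality each coordinate step
    has error at most [e * |h|]. One neighbourhood of 0 serves all [k], so that [h] stays fixed
    during the induction on [k]. *)
Let C1_increment A f x (e : R) : open A -> Ck 1 A f -> A x -> 0 < e ->
  \forall h \near (0 : 'rV[R]_m), forall k, (k <= m)%N ->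
  `|f (x + trunc k h) - f x
    - \sum_(i < m | (i < k)%N) h 0 i * 'D_(delta_mx 0 i) f x| <= k%:R * e * `|h|.
Proof.
move=> oA [_ fd] Ax e0.
have near_d : \forall y \near x, forall i,
    `|'D_(delta_mx 0 i) f y - 'D_(delta_mx 0 i) f x| <= e.
  apply: (@filter_forall _ _ (fun i y => `|'D_(delta_mx 0 i) f y
    - 'D_(delta_mx 0 i) f x| <= e) (nbhs x)) => i; have [_ [dc _]] := fd i.
  have /cvgrPdist_le /(_ _ e0) := dc _ (mem_set Ax).
  by apply: filterS => y; rewrite distrC.
have : nbhs x (A `&` [set y | forall i,
    `|'D_(delta_mx 0 i) f y - 'D_(delta_mx 0 i) f x| <= e]).
  exact: filterI (open_nbhs_nbhs (conj oA Ax)) near_d.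
move=> /nbhs_ballP[r /= r0 xr].
near=> h; elim=> [|k IH] km.
  rewrite big1 // subr0 (_ : trunc 0 h = 0) ?addr0 ?subrr ?normr0 ?mul0r //.
  by apply/rowP => j; rewrite !mxE.
have hr : `|h| < r.
  near: h; apply/nbhs_ballP; exists r => //= h.
  by rewrite -ball_normE /= sub0r normrN.
set i0 := Ordinal km.
rewrite (truncS h km) -/i0 addrA (bigD1 i0) //=.
rewrite (eq_bigl (fun i : 'I_m => (i < k)%N)); last first.
  move=> i; rewrite ltnS leq_eqVlt -(inj_eq val_inj) /= andb_orl andbN /=.
  by case: ltngtP.
set S := \sum_(i < m | _) _; set y := x + trunc k h.
have step : `|f (y + h 0 i0 *: delta_mx 0 i0) - f y
     - 'D_(delta_mx 0 i0) f x * h 0 i0| <= e * `|h 0 i0|.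
  (* Each coordinate of the displacement from [x] is bounded by the corresponding coordinate of [h],
     so the whole segment stays in the ball. *)
  have near_y s : `|s| <= `|h 0 i0| -> ball x r (y + s *: delta_mx 0 i0).
    move=> sh; rewrite -ball_normE /= /y -addrA opprD addNKr normrN.
    apply: le_lt_trans hr; apply: le_norm => j; rewrite !mxE eqxx /=.
    case: (eqVneq j i0) => [->|_]; first by rewrite /= ltnn add0r mulr1.
    by rewrite mulr0 addr0; case: ifP => // _; rewrite normr0.
  have := @le_increment (fun s => f (y + s *: delta_mx 0 i0))
    (fun s => 'D_(delta_mx 0 i0) f (y + s *: delta_mx 0 i0))
    ('D_(delta_mx 0 i0) f x) e (h 0 i0).
  rewrite scale0r addr0; apply => s /near_y /xr [As es].
    by apply: is_derive_line; exact: (fd i0).1.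
  exact: es.
rewrite (_ : _ - _ - _ = (f (y + h 0 i0 *: delta_mx 0 i0) - f y
     - 'D_(delta_mx 0 i0) f x * h 0 i0) + (f y - f x - S)); last first.
  by ring.
apply: le_trans (ler_normD _ _) _; rewrite -natr1 addrC !mulrDl mul1r lerD //.
  exact: IH (ltnW km).
by apply: le_trans step _; rewrite ler_pM2l.
Unshelve. all: by end_near. Qed.

(** The differential is the linear form with the partial derivatives as coefficients; [C1_increment]
    at [k = m] shows that the remainder is negligible. *)
Lemma C1_differentiable A f x :
  open A -> Ck 1 A f -> A x -> differentiable f x.
Proof.
move=> oA Cf Ax.
have df_lin : linear (fun h : 'rV[R]_m =>
    \sum_(i < m) h 0 i * 'D_(delta_mx 0 i) f x : R^o).
  move=> a u v; rewrite scaler_sumr -big_split /=; apply: eq_bigr => i _.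
  by rewrite !mxE mulrDl scalerAl.
pose dfM := GRing.isLinear.Build _ _ _ _ _ df_lin.
pose df : {linear 'rV[R]_m -> R^o} := HB.pack (fun h : 'rV[R]_m =>
  \sum_(i < m) h 0 i * 'D_(delta_mx 0 i) f x : R^o) dfM.
have dfc : continuous df.
  move=> h; apply: differentiable_continuous.
  rewrite (_ : df = \sum_(i < m) (fun h : 'rV[R]_m =>
      h 0 i * 'D_(delta_mx 0 i) f x) :> ('rV[R]_m -> R)); last first.
    by apply/funext => u; rewrite fct_sumE.
  apply: differentiable_sum => i.
  by apply: differentiableM => //; exact: differentiable_coord.
have E : f \o shift x = cst (f x) + df +o_ (0 : 'rV[R]_m) id.
  apply/eqaddoP => _ /posnumP[e].
  (* The [m] coordinate steps cost at most [m / m.+1] times [e]; the denominator [m.+1] is nonzero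
     also for [m = 0]. *)
  have e0 : 0 < e%:num / m.+1%:R by rewrite divr_gt0.
  near=> h.
  have /(_ m (leqnn m)) : forall k, (k <= m)%N ->
    `|f (x + trunc k h) - f x - \sum_(i < m | (i < k)%N)
      h 0 i * 'D_(delta_mx 0 i) f x| <= k%:R * (e%:num / m.+1%:R) * `|h|.
    by near: h; exact: C1_increment Cf Ax e0.
  rewrite (eq_bigl xpredT) => [|i]; last exact: ltn_ord.
  rewrite (_ : trunc m h = h); last first.
    by apply/rowP => j; rewrite !mxE ltn_ord.
  move=> fh; rewrite [leLHS](_ : _ = `|f (x + h) - f x - df h|); last first.
    by rewrite /= !fctE /= opprD addrA [x + h]addrC.
  apply: le_trans fh _; apply: ler_wpM2r => //.
  rewrite mulrCA ler_piMr // ler_pdivrMr ?mul1r ?ler_nat //.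
have dE := diff_unique dfc E.
by apply/diff_locallyP; rewrite dE; split.
Unshelve. all: by end_near. Qed.

End Calculus.

(** * Linear subspaces as sets *)

Section Subspace.
Context {R : realType} {V : lmodType R}.

(** Tangent spaces, vertical spaces and fibres of distributions are subsets of the function space
    [tvec R M], so linear algebra is done relative to a set. *)
Definition linear_subspace (S : set V) : Prop :=
  S 0 /\ forall (a : R) u v, S u -> S v -> S (a *: u + v).

Variable S : set V.
Hypothesis S_subspace : linear_subspace S.

Lemma subspaceZ (a : R) u : S u -> S (a *: u).
Proof. by case: S_subspace => S0 SL Su; rewrite -[_ *: _]addr0; exact: SL. Qed.

Lemma subspaceD u v : S u -> S v -> S (u + v).
Proof. by case: S_subspace => _ SL; rewrite -[u in u + v]scale1r; exact: SL. Qed.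

Lemma subspaceN u : S u -> S (- u).
Proof. by rewrite -scaleN1r; exact: subspaceZ. Qed.

Lemma subspaceB u v : S u -> S v -> S (u - v).
Proof. by move=> Su Sv; apply: subspaceD => //; exact: subspaceN. Qed.

Lemma subspace_sum (I : Type) (s : seq I) (P : pred I) (u : I -> V) :
  (forall i, S (u i)) -> S (\sum_(i <- s | P i) u i).
Proof.
by move=> Su; elim/big_ind: _ => //; [case: S_subspace|exact: subspaceD].
Qed.

End Subspace.

(** * Smooth functions on a manifold *)

Section SmoothFunctions.
Context {R : realType} {m : nat} {M : manifold R m}.
Implicit Types (U V : set M) (f g : M -> R) (p : M).

Lemma open_chart_image (c : chart R M m) U :
  open U -> open (c @` (U `&` cdom c)).
Proof.
move=> oU; rewrite openE => _ [p [Up cp] <-].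
have cpE : cinv c (c p) = p by apply: cmapK; exact: mem_set.
have cpI : (c @` cdom c) (c p) by exists p.
have near_cp : nbhs (c p) ((c @` cdom c) `&` cinv c @^-1` U).
  apply: filterI.
    by apply: open_nbhs_nbhs; split => //; exact: cimg_open.
  apply: (cinv_continuous (mem_set cpI)); rewrite cpE.
  exact: open_nbhs_nbhs.
apply: filterS near_cp => _ [[q cq <-]].
rewrite /preimage /= cmapK ?inE // => Uq.
by exists q.
Qed.

Lemma smooth_on_subset U V f : V `<=` U -> smooth_on U f -> smooth_on V f.
Proof.
move=> VU fs c ac k; apply: Ck_subset (fs c ac k).
by apply: image_subset; exact: setSI.
Qed.

Lemma eq_in_smooth_on U f g :
  open U -> {in U, f =1 g} -> smooth_on U f -> smooth_on U g.
Proof.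
move=> oU fg fs c ac k; apply: eq_in_Ck (fs c ac k).
  exact: open_chart_image.
move=> _ /set_mem[p [Up cp] <-] /=.
by rewrite (cmapK (mem_set cp)); exact/fg/mem_set.
Qed.

Lemma smooth_on_cst U (a : R) : smooth_on U (cst a).
Proof. by move=> c ac k; exact: Ck_cst. Qed.

Lemma smooth_onD U f g :
  open U -> smooth_on U f -> smooth_on U g -> smooth_on U (fun p => f p + g p).
Proof.
move=> oU fs gs c ac k.
by apply: (@CkD _ _ k _ (f \o cinv c) (g \o cinv c));
  [exact: open_chart_image|exact: fs|exact: gs].
Qed.

Lemma smooth_onM U f g :
  open U -> smooth_on U f -> smooth_on U g -> smooth_on U (fun p => f p * g p).
Proof.
move=> oU fs gs c ac k.
by apply: (@CkM _ _ k _ (f \o cinv c) (g \o cinv c));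
  [exact: open_chart_image|exact: fs|exact: gs].
Qed.

Lemma smooth_on_differentiable U f (c : chart R M m) p :
  open U -> smooth_on U f -> atlas c -> U p -> cdom c p ->
  differentiable (f \o cinv c) (c p).
Proof.
move=> oU fs ac Up cp; apply: C1_differentiable (fs c ac 1%N) _.
  exact: open_chart_image.
by exists p.
Qed.

End SmoothFunctions.

(** * Tangent spaces are vector spaces *)

Section TangentSpace.
Context {R : realType} {m : nat} {M : manifold R m}.
Implicit Types (U V : set M) (p : M) (u v : tvec R M).

Lemma differentiable_row (k : nat) (V : normedModType R)
    (f : V -> 'rV[R]_k) (x : V) :
  (forall j, differentiable (fun y => f y 0 j) x) -> differentiable f x.
Proof.
move=> df; rewrite (_ : f = \sum_(j < k) (fun y => f y 0 j *: delta_mx 0 j)).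
  by apply: differentiable_sum => j; exact: differentiableZl.
by apply/funext => y; rewrite fct_sumE [LHS]row_sum_delta.
Qed.

(* Chain rule for the transition map from [c] to [d]. *)
Lemma tangent_change_chart (c d : chart R M m) p (v : 'rV[R]_m) :
  atlas c -> atlas d -> cdom c p -> cdom d p ->
  exists w : 'rV[R]_m, on_germs p (fun f => 'D_v (f \o cinv c) (c p)) =
    on_germs p (fun f => 'D_w (f \o cinv d) (d p)).
Proof.
move=> ac ad cp dp; pose phi (x : 'rV[R]_m) : 'rV[R]_m := d (cinv c x).
pose A := c @` (cdom d `&` cdom c).
have oA : open A by apply: open_chart_image; exact: cdom_open.
have Acp : A (c p) by exists p.
have phip : phi (c p) = d p by rewrite /phi cmapK ?inE.
have dphi : differentiable phi (c p).
  apply: differentiable_row => j; apply: (@C1_differentiable _ _ A) => //.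
  by rewrite /A setIC; exact: atlas_smooth.
exists ('d phi (c p) v); apply/funext => f; rewrite /on_germs.
case: asboolP => // -[U [oU Up fs]].
have df : differentiable (f \o cinv d) (phi (c p)).
  by rewrite phip; exact: smooth_on_differentiable fs ad Up dp.
rewrite -phip [RHS](deriveE _ df).
rewrite -[RHS]/(('d (f \o cinv d) (phi (c p)) \o 'd phi (c p)) v).
rewrite -(diff_comp dphi df) -deriveE; last exact: differentiable_comp.
apply: near_eq_derive; apply: (open_near_eq oA Acp) => _ /set_mem[q [dq cq] <-].
by rewrite /= /phi (cmapK (mem_set cq)) (cmapK (mem_set dq)).
Qed.

Lemma tangent0 p : tangent p (0 : tvec R M).
Proof.
have [c ac cp] := atlas_cover p; exists c, 0; split => //.
by apply/funext => f; rewrite /on_germs; case: ifP => // _; rewrite derive0.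
Qed.

(** The second vector is first moved to the chart of the first. Additivity of the directional
    derivative in the direction then comes from differentiability, which is why [C1_differentiable]
    is proved. *)
Lemma tangent_linear p (a : R) u v :
  tangent p u -> tangent p v -> tangent p (a *: u + v).
Proof.
move=> [c [x [ac cp ->]]] [d [y [ad dp ->]]].
have [z ->] := tangent_change_chart y ad ac dp cp.
exists c, (a *: x + z); split => //; apply/funext => f.
rewrite -[LHS]/(a * on_germs p (fun f => 'D_x (f \o cinv c) (c p)) f +
  on_germs p (fun f => 'D_z (f \o cinv c) (c p)) f) /on_germs.
case: ifPn => [/asboolP[U [oU Up fs]]|_]; last by rewrite mulr0 addr0.
have df := smooth_on_differentiable oU fs ac Up cp.
by rewrite !(deriveE _ df) linearP.
Qed.

Lemma tangent_subspace p : linear_subspace (tangent p).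
Proof. by split; [exact: tangent0|exact: tangent_linear]. Qed.

Lemma tangent_cst U p v f (a : R) : open U -> U p -> tangent p v ->
  {in U, f =1 cst a} -> v f = 0.
Proof.
move=> oU Up [c [x [ac cp ->]]] fa; rewrite /on_germs; case: ifP => // _.
rewrite (@near_eq_derive _ _ _ _ (cst a)) ?derive_cst //.
apply: (@open_near_eq _ _ (c @` (U `&` cdom c))).
- exact: open_chart_image.
- by exists p.
- by move=> _ /set_mem[q [Uq cq] <-] /=; rewrite (cmapK (mem_set cq)) fa ?inE.
Qed.

End TangentSpace.

(** * Vector fields and sections along a map *)

Section VectorFields.
Context {R : realType} {m : nat} {M : manifold R m}.
Implicit Types (U V : set M) (p : M) (X Y : M -> tvec R M).

Lemma vector_field_subset U V X : V `<=` U -> vector_field U X -> vector_field V X.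
Proof.
move=> VU [tX sX]; split => [p /VU /tX //|W f oW fs].
by apply: smooth_on_subset (sX W f oW fs); exact: setSI.
Qed.

Lemma eq_in_vector_field U X Y :
  open U -> {in U, X =1 Y} -> vector_field U X -> vector_field U Y.
Proof.
move=> oU XY [tX sX]; split => [p Up|W f oW fs].
  by rewrite -XY ?inE //; exact: tX.
apply: eq_in_smooth_on (sX W f oW fs); first exact: openI.
by move=> p /set_mem[Up _]; rewrite XY ?inE.
Qed.

Lemma section_along0 (n : nat) (N : manifold R n) (F : M -> N) U :
  section_along F U (fun=> 0).
Proof.
by split=> [p _|W f _ _]; [exact: tangent0|exact: smooth_on_cst].
Qed.

Lemma eq0_section_along (n : nat) (N : manifold R n) (F : M -> N) U s :
  continuous F -> open U -> {in U, s =1 (fun=> 0)} -> section_along F U s.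
Proof.
move=> cF oU s0; split=> [p Up|W f oW _].
  by rewrite s0 ?inE //; exact: tangent0.
apply: eq_in_smooth_on (smooth_on_cst _ 0).
  by apply: openI => //; move/continuousP: cF; exact.
by move=> p /set_mem[Up _]; rewrite s0 ?inE.
Qed.

Lemma vector_fieldD U X Y : open U -> vector_field U X -> vector_field U Y ->
  vector_field U (fun p => X p + Y p).
Proof.
move=> oU [tX sX] [tY sY]; split => [p Up|W f oW fs].
  by apply: (subspaceD (tangent_subspace _)); [exact: tX|exact: tY].
by apply: smooth_onD; [exact: openI|exact: sX|exact: sY].
Qed.

Lemma vector_fieldZ U f X : open U -> smooth_on U f -> vector_field U X ->
  vector_field U (fun p => f p *: X p).
Proof.
move=> oU fs [tX sX]; split => [p Up|W h oW hs].
  by apply: (subspaceZ (tangent_subspace _)); exact: tX.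
apply: smooth_onM; [exact: openI| |exact: sX].
by apply: smooth_on_subset fs => p [].
Qed.

Lemma vector_fieldB U X Y : open U -> vector_field U X -> vector_field U Y ->
  vector_field U (fun p => X p - Y p).
Proof.
move=> oU fX fY; apply: eq_in_vector_field (vector_fieldD oU fX
  (vector_fieldZ oU (@smooth_on_cst _ _ _ _ (-1)) fY)) => // p _.
by rewrite scaleN1r.
Qed.

Lemma vector_field_sum U (I : finType) (X : I -> M -> tvec R M) :
  open U -> (forall i, vector_field U (X i)) ->
  vector_field U (fun p => \sum_i X i p).
Proof.
move=> oU fX; suff: forall s : seq I, vector_field U (fun p => \sum_(i <- s) X i p).
  exact.
elim=> [|i s IH].
  apply: eq_in_vector_field (section_along0 id U) => // p _.
  by rewrite big_nil.
apply: eq_in_vector_field (vector_fieldD oU (fX i) IH) => // p _.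
by rewrite big_cons.
Qed.

End VectorFields.

(** * Maps that are linear on a subspace *)

Section LinearOn.
Context {R : realType} {V W : lmodType R} {A : set V} {f : V -> W}.
Hypotheses (A_subspace : linear_subspace A) (f_linear : linear_on A f).

Lemma linear_on0 : f 0 = 0.
Proof.
have [A0 _] := A_subspace; have := f_linear 1 A0 A0.
by rewrite !scale1r addr0 => /eqP; rewrite -subr_eq0 opprD addNKr oppr_eq0 => /eqP.
Qed.

Lemma linear_onZ (a : R) u : A u -> f (a *: u) = a *: f u.
Proof.
have [A0 _] := A_subspace => Au.
by rewrite -[a *: u]addr0 f_linear // linear_on0 addr0.
Qed.

Lemma linear_onD u v : A u -> A v -> f (u + v) = f u + f v.
Proof. by move=> Au Av; rewrite -[u in LHS]scale1r f_linear // scale1r. Qed.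

Lemma linear_onN u : A u -> f (- u) = - f u.
Proof. by move=> Au; rewrite -scaleN1r linear_onZ // scaleN1r. Qed.

Lemma linear_onB u v : A u -> A v -> f (u - v) = f u - f v.
Proof.
by move=> Au Av; rewrite linear_onD ?linear_onN //; exact: subspaceN.
Qed.

Lemma linear_on_sum (I : finType) (u : I -> V) :
  (forall i, A (u i)) -> f (\sum_i u i) = \sum_i f (u i).
Proof.
move=> Au; suff: forall s : seq I, f (\sum_(i <- s) u i) = \sum_(i <- s) f (u i).
  exact.
elim=> [|i s IH]; first by rewrite !big_nil linear_on0.
by rewrite !big_cons linear_onD ?IH //; exact: subspace_sum.
Qed.

End LinearOn.

(** * Riemannian metrics and orthogonal projection *)

Section Metric.
Context {R : realType} {m : nat} {M : manifold R m}.
Context {g : M -> tvec R M -> tvec R M -> R}.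
Hypothesis g_metric : riemannian_metric g.
Implicit Types (U V : set M) (p : M) (u v w : tvec R M).

Let lin p u : tangent p u -> linear_on (tangent p) (g p u : _ -> R^o).
Proof. exact: metric_linear. Qed.

Lemma metric0r p u : tangent p u -> g p u 0 = 0.
Proof. by move=> pu; exact: linear_on0 (tangent_subspace p) (lin pu). Qed.

Lemma metricDr p u v w : tangent p u -> tangent p v -> tangent p w ->
  g p u (v + w) = g p u v + g p u w.
Proof. by move=> pu; exact: linear_onD (lin pu) _ _. Qed.

Lemma metricZr p (a : R) u v : tangent p u -> tangent p v ->
  g p u (a *: v) = a * g p u v.
Proof. by move=> pu; exact: linear_onZ (tangent_subspace p) (lin pu) _ _. Qed.

Lemma metricNr p u v : tangent p u -> tangent p v -> g p u (- v) = - g p u v.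
Proof. by move=> pu; exact: linear_onN (tangent_subspace p) (lin pu) _. Qed.

Lemma metricBr p u v w : tangent p u -> tangent p v -> tangent p w ->
  g p u (v - w) = g p u v - g p u w.
Proof. by move=> pu; exact: linear_onB (tangent_subspace p) (lin pu) _ _. Qed.

Lemma metric_sumr p (I : finType) u (v : I -> tvec R M) :
  tangent p u -> (forall i, tangent p (v i)) ->
  g p u (\sum_i v i) = \sum_i g p u (v i).
Proof. by move=> pu; exact: linear_on_sum (tangent_subspace p) (lin pu) _ _. Qed.

Lemma metricBl p u v w : tangent p u -> tangent p v -> tangent p w ->
  g p (v - w) u = g p v u - g p w u.
Proof.
move=> pu pv pw; have pvw := subspaceB (tangent_subspace p) pv pw.
by rewrite !(Defs.metric_sym g_metric _ pu) // metricBr.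
Qed.

Lemma metric_eq0 p u : tangent p u -> g p u u = 0 -> u = 0.
Proof.
move=> pu /eqP; apply: contraTeq => u0.
by rewrite gt_eqF // (metric_pos g_metric).
Qed.

Lemma orth_in_subspace p (A B : set (tvec R M)) :
  linear_subspace A -> A `<=` tangent p -> B `<=` tangent p ->
  linear_subspace (orth_in g p A B).
Proof.
move=> sA At Bt; split=> [|a u v [Au uB] [Av vB]].
  split=> [|w /Bt pw]; first by case: sA.
  by rewrite (Defs.metric_sym g_metric) ?metric0r //; exact: tangent0.
split=> [|w Bw]; first exact: sA.2.
have [tw tu tv] := And3 (Bt _ Bw) (At _ Au) (At _ Av).
rewrite (Defs.metric_sym g_metric) //; last exact: tangent_linear.
rewrite (metric_linear g_metric) // !(Defs.metric_sym g_metric tw) //.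
by rewrite uB // vB // scaler0 addr0.
Qed.

(** Gram-Schmidt by induction on [k]: [u] and [x ord0] are projected off the other vectors, leaving
    [u'] and [y], and then the component of [u'] along [y] is removed. The [x i] may be linearly
    dependent. *)
Lemma orthogonal_decomposition p k (x : 'I_k -> tvec R M) u :
  (forall i, tangent p (x i)) -> tangent p u ->
  exists a : 'I_k -> R, forall i, g p (u - \sum_j a j *: x j) (x i) = 0.
Proof.
elim: k x u => [|k IH] x u tx tu; first by exists (fun=> 0) => -[].
have St := tangent_subspace (p : M).
pose x' (i : 'I_k) := x (lift ord0 i).
have tx' i : tangent p (x' i) by exact: tx.
have [a au] := IH x' u tx' tu; have [b bx] := IH x' (x ord0) tx' (tx ord0).
have tsum (c : 'I_k -> R) : tangent p (\sum_j c j *: x' j).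
  by apply: (subspace_sum St) => j; exact: (subspaceZ St).
set u' := u - _ in au; set y := x ord0 - _ in bx.
have tu' : tangent p u' by exact: (subspaceB St).
have ty : tangent p y by exact: (subspaceB St).
(* The division gives [t = 0] when [x ord0] lies in the span of the others. *)
pose t := g p u' y / g p y y.
have tt : tangent p (t *: y) by exact: (subspaceZ St).
(* Expanding [y = x ord0 - \sum_j b j *: x' j] in [\sum_j a j *: x' j + t *: y] gives these
   coefficients. *)
exists (fun j => if unlift ord0 j is Some i then a i - t * b i else t) => j.
rewrite big_ord_recl unlift_none.
rewrite (_ : _ - _ = u' - t *: y); last first.
  rewrite (_ : \sum_(i < k) _ = \sum_j a j *: x' j - t *: \sum_j b j *: x' j).
    by rewrite addrCA opprD addrA -scalerBr.
  rewrite scaler_sumr -sumrB; apply: eq_bigr => i _.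
  by rewrite liftK scalerBl scalerA.
have orth' i : g p (u' - t *: y) (x' i) = 0.
  rewrite metricBl // au (Defs.metric_sym g_metric) // metricZr //.
  by rewrite (Defs.metric_sym g_metric) // bx mulr0 subr0.
case: (unliftP ord0 j) => [i|] ->; first exact: orth'.
have txy : x ord0 = y + \sum_j b j *: x' j by rewrite subrK.
have tuy := subspaceB St tu' tt.
rewrite [in x ord0]txy metricDr // metric_sumr //; last first.
  by move=> i; exact: (subspaceZ St).
rewrite big1 ?addr0 => [|i _]; last by rewrite metricZr // orth' mulr0.
rewrite metricBl // (Defs.metric_sym g_metric tt ty) metricZr // /t.
have [gy|gy] := eqVneq (g p y y) 0; last by rewrite divfK // subrr.
by rewrite (metric_eq0 ty gy) metric0r // !mul0r subrr.
Qed.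

End Metric.

(** * Lie brackets and connections *)

Section LeviCivita.
Context {R : realType} {m : nat} {M : manifold R m}.
Context {g : M -> tvec R M -> tvec R M -> R}.
Context {nabla : M -> tvec R M -> (M -> tvec R M) -> tvec R M}.
Hypothesis nabla_LC : levi_civita g nabla.
Implicit Types (U V : set M) (p : M) (v : tvec R M) (X Y : M -> tvec R M).

Let conn := lc_connection nabla_LC.

(** Torsion-freeness writes the bracket as a difference of covariant derivatives, so no second-order
    terms have to be cancelled in charts. *)
Lemma lie_bracket_vector_field U X Y : open U ->
  vector_field U X -> vector_field U Y -> vector_field U (lie_bracket X Y).
Proof.
move=> oU fX fY.
apply: (eq_in_vector_field oU _ (vector_fieldB oU
  (connection_smooth conn oU fX fY) (connection_smooth conn oU fY fX))).
by move=> p /set_mem Up; exact: (lc_torsion_free nabla_LC oU Up fX fY).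
Qed.

End LeviCivita.

Section ConnectionAlong.
Context {R : realType} {m n : nat} {M : manifold R m} {N : manifold R n}.
Context {F : M -> N} {D : M -> tvec R M -> (M -> tvec R N) -> tvec R N}.
Hypothesis D_conn : connection_along F D.
Implicit Types (U V : set M) (p : M) (v : tvec R M).

(** The zero section is 0 times itself, so its derivative vanishes by the Leibniz rule; locality
    transfers this to [s]. *)
Lemma connection0 U p v s : open U -> U p -> tangent p v ->
  {in U, s =1 fun=> 0} -> D p v s = 0.
Proof.
move=> oU Up tv s0.
have f0 : section_along F U (fun=> 0) by exact: section_along0.
rewrite -(connection_local D_conn oU Up tv f0) => [|q qU]; last by rewrite s0.
have := connection_leibniz D_conn oU Up tv (@smooth_on_cst _ _ _ _ 0) f0.
rewrite (_ : (fun q => cst 0 q *: _) = fun=> 0); last first.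
  by apply/funext => q; rewrite scaler0.
by rewrite scaler0 add0r => ->; exact: scale0r.
Qed.

End ConnectionAlong.

Section Connection.
Context {R : realType} {m : nat} {M : manifold R m}.
Context {D : M -> tvec R M -> (M -> tvec R M) -> tvec R M}.
Hypothesis D_conn : connection_along id D.
Implicit Types (U V : set M) (p : M) (v : tvec R M).

Lemma connection_sum U p v (I : finType) (X : I -> M -> tvec R M) :
  open U -> U p -> tangent p v -> (forall i, vector_field U (X i)) ->
  D p v (fun q => \sum_i X i q) = \sum_i D p v (X i).
Proof.
move=> oU Up tv fX.
(* Smoothness of the partial sums is carried along because [connection_add] requires it. *)
suff: forall s : seq I, vector_field U (fun q => \sum_(i <- s) X i q) /\
    D p v (fun q => \sum_(i <- s) X i q) = \sum_(i <- s) D p v (X i).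
  by move=> /(_ (index_enum I))[].
elim=> [|i s [fs IH]].
  split; last first.
    by rewrite big_nil (connection0 D_conn oU Up) // => q _; rewrite big_nil.
  by apply: eq_in_vector_field (section_along0 id U) => // q _; rewrite big_nil.
have E : (fun q => \sum_(i <- i :: s) X i q) =
    (fun q => X i q + \sum_(i <- s) X i q).
  by apply/funext => q; rewrite big_cons.
rewrite E big_cons -IH; split; first exact: vector_fieldD.
exact: (connection_add D_conn oU Up tv (fX i) fs).
Qed.

Lemma connection_sumZ U p v (I : finType) (f : I -> M -> R)
    (X : I -> M -> tvec R M) :
  open U -> U p -> tangent p v ->
  (forall i, smooth_on U (f i)) -> (forall i, vector_field U (X i)) ->
  D p v (fun q => \sum_i f i q *: X i q) =
    \sum_i (v (f i) *: X i p + f i p *: D p v (X i)).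
Proof.
move=> oU Up tv fs fX; rewrite (connection_sum oU Up tv).
  apply: eq_bigr => i _.
  exact: (connection_leibniz D_conn oU Up tv (fs i) (fX i)).
by move=> i; exact: vector_fieldZ.
Qed.

End Connection.

(** * The differential of [F] and vertical fields *)

Section VerticalFields.
Context {R : realType} {m n : nat} {M : manifold R m} {N : manifold R n}.
Variable F : M -> N.
Implicit Types (U : set M) (p : M) (v : tvec R M) (X Y : M -> tvec R M).

Lemma tangent_map_linear p (a : R) u v :
  tangent_map F p (a *: u + v) = a *: tangent_map F p u + tangent_map F p v.
Proof.
apply/funext => f; rewrite -[RHS]/(a * tangent_map F p u f + tangent_map F p v f).
by rewrite /tangent_map /on_germs; case: ifP => // _; rewrite mulr0 addr0.
Qed.

Lemma tangent_map0 p : tangent_map F p 0 = 0.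
Proof.
by apply/funext => f; rewrite /tangent_map /on_germs; case: ifP.
Qed.

Lemma tangent_mapZ p (a : R) u : tangent_map F p (a *: u) = a *: tangent_map F p u.
Proof. by rewrite -[_ *: u]addr0 tangent_map_linear tangent_map0 addr0. Qed.

Lemma tangent_mapD p u v :
  tangent_map F p (u + v) = tangent_map F p u + tangent_map F p v.
Proof. by rewrite -[u in LHS]scale1r tangent_map_linear scale1r. Qed.

Lemma tangent_mapN p u : tangent_map F p (- u) = - tangent_map F p u.
Proof. by rewrite -scaleN1r tangent_mapZ scaleN1r. Qed.

Lemma tangent_mapB p u v :
  tangent_map F p (u - v) = tangent_map F p u - tangent_map F p v.
Proof. by rewrite tangent_mapD tangent_mapN. Qed.

Lemma vertical_subspace p : linear_subspace (vertical F p).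
Proof.
split; first by split; [exact: tangent0|exact: tangent_map0].
move=> a u v [tu Fu] [tv Fv]; split; first exact: tangent_linear.
by rewrite tangent_map_linear Fu Fv scaler0 addr0.
Qed.

(* [lie_bracket X Y p] vanishes by definition on the functions that are not
   smooth near [p], so that smoothness of [f \o F] is never needed. *)
Lemma lie_bracket_tangent_map U X Y p : continuous F -> open U -> U p ->
  (forall q, U q -> vertical F q (X q)) -> (forall q, U q -> vertical F q (Y q)) ->
  tangent_map F p (lie_bracket X Y p) = 0.
Proof.
move=> cF oU Up vX vY; apply/funext => f.
rewrite /tangent_map /on_germs; case: ifPn => // /asboolP[W [oW WFp fs]].
(* [f] is smooth near [F q] for every [q] in the preimage of [W], so [F_* Z = 0] may be evaluated at
   [f]. In the bracket, [X] and [Y] thus differentiate functions that vanish near [p]. *)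
have killed Z : (forall q, U q -> vertical F q (Z q)) ->
    {in U `&` F @^-1` W, (fun q => Z q (f \o F)) =1 cst 0}.
  move=> vZ q /set_mem[Uq Wq]; have [_ /(congr1 (fun d => d f))] := vZ q Uq.
  rewrite /tangent_map /on_germs; case: ifPn => // /asboolP[].
  by exists W.
have oUW : open (U `&` F @^-1` W).
  by apply: openI => //; move/continuousP: cF; exact.
rewrite /lie_bracket /on_germs; case: ifP => // _.
have UWp : (U `&` F @^-1` W) p by split.
rewrite (tangent_cst oUW UWp (vX p Up).1 (killed Y vY)).
by rewrite (tangent_cst oUW UWp (vY p Up).1 (killed X vX)) subrr.
Qed.

End VerticalFields.

(** * Quaternionic Hermitian bases *)

Lemma Z3_cases (al be : 'Z_3) : [\/ be = al, be = al + 1 | al = be + 1].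
Proof.
by move: al be => [[|[|[|//]]] ia] [[|[|[|//]]] ib];
  first [constructor 1; exact: val_inj | constructor 2; exact: val_inj
        | constructor 3; exact: val_inj].
Qed.

Section QuaternionicHermitian.
Context {R : realType} {m : nat} {M : manifold R m}.
Context {g : M -> tvec R M -> tvec R M -> R}.
Context {E : M -> set (tvec R M -> tvec R M)} {U : set M}.
Context {J : 'Z_3 -> M -> tvec R M -> tvec R M}.
Hypothesis g_metric : riemannian_metric g.
Hypothesis J_basis : quaternionic_hermitian_basis g E U J.
Implicit Types (V : set M) (p : M) (v : tvec R M) (al be : 'Z_3).

Lemma qh_tangent al p v : U p -> tangent p v -> tangent p (J al p v).
Proof.
move=> Up tv; have [_ Jt] := (qh_smooth J_basis al).1 p Up.
by apply: Jt; exists v.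
Qed.

Lemma qh_linear al p : U p -> linear_on (tangent p) (J al p).
Proof. by move=> Up; have [] := (qh_smooth J_basis al).1 p Up. Qed.

Lemma qh_vector_field al V X : open V -> V `<=` U -> vector_field V X ->
  vector_field V (fun p => J al p (X p)).
Proof. exact: (qh_smooth J_basis al).2. Qed.

(** Isometry applied to [u] and [J al p v], together with [J^2 = -1]. *)
Lemma qh_skew al p u v : U p -> tangent p u -> tangent p v ->
  g p (J al p u) v = - g p u (J al p v).
Proof.
move=> Up tu tv; have tJ := @qh_tangent al p _ Up.
rewrite -(qh_isometry J_basis al Up tu (tJ _ tv)) (qh_sqr J_basis) //.
by rewrite metricNr ?opprK //; exact: tJ.
Qed.

Lemma qh_orthogonal_self al p v : U p -> tangent p v -> g p v (J al p v) = 0.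
Proof.
move=> Up tv; have tJv := @qh_tangent al p _ Up tv.
have := qh_skew al Up tv tv; rewrite (Defs.metric_sym g_metric) //.
by move=> ?; lra.
Qed.

(** For consecutive indices, skewness and the product rule turn the pairing into
    [- g(v, J_(al+2) v)], which is 0. Distinct indices modulo 3 are consecutive in one of the two
    orders. *)
Lemma qh_orthogonal al be p v : U p -> tangent p v -> al != be ->
  g p (J al p v) (J be p v) = 0.
Proof.
move=> Up tv; have tJ := fun ga => @qh_tangent ga p _ Up.
have succ ga : g p (J ga p v) (J (ga + 1) p v) = 0.
  rewrite qh_skew //; last exact: tJ.
  by rewrite (qh_mul J_basis) // qh_orthogonal_self ?oppr0.
have [->|->|->] := Z3_cases al be; first by rewrite eqxx.
  by move=> _; exact: succ.
by move=> _; rewrite (Defs.metric_sym g_metric) ?succ //; exact: tJ.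
Qed.

(** Membership in the global bundle [E] is what relates two local bases to each other. *)
Lemma qh_mem al p : U p -> E p (J al p).
Proof.
move=> Up; rewrite (qh_span J_basis Up).
exists (fun be => (be == al)%:R) => v tv.
rewrite (bigD1 al) //= eqxx scale1r big1 ?addr0 // => be /negPf ->.
by rewrite scale0r.
Qed.

End QuaternionicHermitian.

(** * The covariant derivative of [J] for an arbitrary quaternionic Hermitian basis *)

Section QuaternionicKaehler.
Context {R : realType} {m : nat} {M : manifold R m}.
Context {g : M -> tvec R M -> tvec R M -> R}.
Context {nabla : M -> tvec R M -> (M -> tvec R M) -> tvec R M}.
Context {E : M -> set (tvec R M -> tvec R M)} {U : set M}.
Context {J : 'Z_3 -> M -> tvec R M -> tvec R M}.
Hypothesis g_metric : riemannian_metric g.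
Hypothesis nabla_LC : levi_civita g nabla.
Hypothesis M_QK : quaternionic_kaehler g E nabla.
Hypothesis J_basis : quaternionic_hermitian_basis g E U J.
Implicit Types (V : set M) (p : M) (v : tvec R M) (al be : 'Z_3).

Let D_conn := lc_connection nabla_LC.

Lemma qh_change_basis (U' : set M) (J' : 'Z_3 -> M -> tvec R M -> tvec R M) al p :
  quaternionic_hermitian_basis g E U' J' -> U p -> U' p ->
  exists a : 'Z_3 -> R,
    forall v, tangent p v -> J' al p v = \sum_be a be *: J be p v.
Proof.
move=> J'_basis Up U'p; have := qh_mem J'_basis al U'p.
by rewrite (qh_span J_basis Up).
Qed.

Lemma span_subspace (V : lmodType R) (I : finType) (x : I -> V) :
  linear_subspace [set y | exists c : I -> R, y = \sum_i c i *: x i].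
Proof.
split; first by exists (fun=> 0); rewrite big1 // => i _; rewrite scale0r.
move=> a _ _ [c ->] [d ->]; exists (fun i => a * c i + d i).
rewrite scaler_sumr -big_split /=; apply: eq_bigr => i _.
by rewrite scalerDl scalerA.
Qed.

(* The basis [J] is the combination of the basis [J'] of [quaternionic_kaehler]
   with coefficients [g (J al X0) (J' be X0) / g X0 X0]; multiplying by
   [g X0 X0] makes their smoothness immediate. *)
Lemma qk_derivative V X0 W p v al :
  open V -> V `<=` U -> V p -> vector_field V X0 -> X0 p != 0 ->
  vector_field V W -> tangent p v ->
  exists c : 'Z_3 -> R, nabla p v (fun q => J al q (W q)) - J al p (nabla p v W)
    = \sum_be c be *: J be p (W p).
Proof.
move=> oV VU Vp fX0 X0p fW tv.
have [_ /(_ p)[U' [J' [w [U'p J'_basis _ nablaJ']]]]] := M_QK.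
pose O := V `&` U'.
have oO : open O by apply: openI => //; exact: qh_open J'_basis.
have Op : O p by [].
have OU : O `<=` U by move=> q [/VU].
have OU' : O `<=` U' by move=> q [].
have fX0O : vector_field O X0 by apply: vector_field_subset fX0 => q [].
have fWO : vector_field O W by apply: vector_field_subset fW => q [].
have fJW := qh_vector_field J_basis al oO OU fWO.
have fJ'W be := qh_vector_field J'_basis be oO OU' fWO.
have tW q : O q -> tangent q (W q) by case: fWO => + _; exact.
have tX0 q : O q -> tangent q (X0 q) by case: fX0O => + _; exact.
pose h q := g q (X0 q) (X0 q).
pose b be q := g q (J al q (X0 q)) (J' be q (X0 q)).
have sh : smooth_on O h by exact: (metric_smooth g_metric oO).
have sb be : smooth_on O (b be).
  apply: (metric_smooth g_metric oO).
    exact: (qh_vector_field J_basis al oO OU fX0O).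
  exact: (qh_vector_field J'_basis be oO OU' fX0O).
(* Writing [J al] as a combination of the [J' be] and pairing with [J' be X0] isolates one
   coefficient, since the [J' be X0] are orthogonal of squared length [h]; that coefficient times
   [h] is [b be]. *)
have bJ' q u : O q -> tangent q u ->
    h q *: J al q u = \sum_be b be q *: J' be q u.
  move=> [Vq U'q] tu; have Uq := VU _ Vq; have tXq := tX0 q (conj Vq U'q).
  have [a aJ] : exists a : 'Z_3 -> R,
      forall v, tangent q v -> J al q v = \sum_be a be *: J' be q v.
    have := qh_mem J_basis al Uq.
    by rewrite (qh_span J'_basis U'q).
  rewrite aJ // scaler_sumr; apply: eq_bigr => be _; rewrite scalerA.
  congr (_ *: _); rewrite /b aJ //.
  have tJ' ga := qh_tangent J'_basis ga U'q tXq.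
  have tsum : tangent q (\sum_ga a ga *: J' ga q (X0 q)).
    apply: (subspace_sum (tangent_subspace _)) => ga.
    exact: (subspaceZ (tangent_subspace _)).
  rewrite (Defs.metric_sym g_metric) // metric_sumr // => [|ga]; last first.
    exact: (subspaceZ (tangent_subspace _)).
  rewrite (bigD1 be) //= metricZr // (qh_isometry J'_basis) // big1 ?addr0.
    by rewrite mulrC.
  move=> ga gabe; rewrite metricZr // (qh_orthogonal g_metric J'_basis) ?mulr0 //.
  by rewrite eq_sym.
pose S := [set y | exists c : 'Z_3 -> R, y = \sum_be c be *: J be p (W p)].
have S_sub : linear_subspace S by exact: span_subspace.
have SJ be : S (J be p (W p)).
  exists (fun ga => (ga == be)%:R).
  rewrite (bigD1 be) //= eqxx scale1r big1 ?addr0 // => ga /negPf ->.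
  by rewrite scale0r.
(* Conversely, at [p] each [J' be] is a combination of the [J ga], so terms in the basis [J'] remain
   in [S]. *)
have SJ' be : S (J' be p (W p)).
  have [a ->] := qh_change_basis be J'_basis (VU _ Vp) U'p; last exact: tW.
  by exists a.
have tnW : tangent p (nabla p v W).
  exact: (connection_tangent D_conn oO Op tv fWO).
have hp : h p != 0.
  by apply: contra_neq X0p; apply: metric_eq0 => //; exact: tX0.
suff [c hc] : S (h p *: (nabla p v (fun q => J al q (W q)) - J al p (nabla p v W))).
  exists (fun be => (h p)^-1 * c be); rewrite -[LHS](scalerK hp) hc scaler_sumr.
  by apply: eq_bigr => be _; rewrite scalerA.
(* Both sides of [h J_al W = \sum_be b_be J'_be W] are differentiated. The terms with a derivative
   of [h] or [b be] lie in [S]; the others combine into [b_be] times [(nabla_v J'_be) W], which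
   [nablaJ'] describes. *)
have leib := connection_leibniz D_conn oO Op tv sh fJW.
have : nabla p v (fun q => h q *: J al q (W q)) =
    nabla p v (fun q => \sum_be b be q *: J' be q (W q)).
  apply: (connection_local D_conn oO Op tv); first exact: vector_fieldZ.
  by move=> q /set_mem Oq; apply: bJ' => //; exact: tW.
rewrite leib (connection_sumZ D_conn oO Op tv sb fJ'W) => E1.
rewrite scalerBr (bJ' p _ Op tnW).
rewrite -[h p *: _](addKr (v h *: J al p (W p))) E1.
rewrite -addrA -sumrB; apply: (subspaceD S_sub).
  by apply: (subspaceN S_sub); exact: (subspaceZ S_sub).
apply: (subspace_sum S_sub) => be; rewrite -addrA -scalerBr.
apply: (subspaceD S_sub); first exact: (subspaceZ S_sub).
apply: (subspaceZ S_sub); rewrite (nablaJ' O) //.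
by apply: (subspaceB S_sub); exact: (subspaceZ S_sub).
Qed.

End QuaternionicKaehler.

(** * The distributions [D1] and [D2] of a semi-invariant submersion and their integrability *)

Section SemiInvariantSubmersion.
Context {R : realType} {m n : nat} {M : manifold R m} {N : manifold R n}.
Context {E : M -> set (tvec R M -> tvec R M)}.
Context {gM : M -> tvec R M -> tvec R M -> R}.
Context {nablaM : M -> tvec R M -> (M -> tvec R M) -> tvec R M}.
Context {F : M -> N} {nablaF : M -> tvec R M -> (M -> tvec R N) -> tvec R N}.
Context {U : set M} {J : 'Z_3 -> M -> tvec R M -> tvec R M}.
Context {D1 : M -> set (tvec R M)}.
Hypothesis nablaM_LC : levi_civita gM nablaM.
Hypothesis M_QK : quaternionic_kaehler gM E nablaM.
Hypothesis nablaF_conn : connection_along F nablaF.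
Hypothesis F_continuous : continuous F.
Hypothesis J_basis : semi_invariant_basis gM F E U J D1.
Implicit Types (A : set M) (p : M) (u v x : tvec R M) (al be : 'Z_3).

Let D2 := D2_of gM F D1.

Let gM_metric : riemannian_metric gM.
Proof. by have [[]] := M_QK. Qed.

Let nablaM_conn := lc_connection nablaM_LC.
Let J_qh := si_basis J_basis.
Let U_open : open U := qh_open J_qh.

Let D1_vertical p : U p -> D1 p `<=` vertical F p.
Proof. exact: si_vertical J_basis p. Qed.

Let D1_tangent p : U p -> D1 p `<=` tangent p.
Proof. by move=> Up x /(D1_vertical Up)[]. Qed.

Let D2_vertical p : D2 p `<=` vertical F p.
Proof. by move=> x []. Qed.

Lemma D1_subspace p : U p -> linear_subspace (D1 p).
Proof.
move=> Up; have [A [k [X [[_ Op _ _] /(_ p Op)[_ ->]]]]] := si_distr J_basis Up.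
exact: span_subspace.
Qed.

Lemma D1_invariant al p x : U p -> D1 p x -> D1 p (J al p x).
Proof. by move=> Up D1x; rewrite -(si_D1 J_basis al Up); exists x. Qed.

Lemma D2_horizontal al p x : U p -> D2 p x -> horizontal gM F p (J al p x).
Proof. by move=> Up D2x; apply: (si_D2 J_basis (al := al) Up); exists x. Qed.

Lemma horizontal_vertical_eq0 p x : horizontal gM F p x -> vertical F p x -> x = 0.
Proof.
by move=> [tx hx] vx; apply: (metric_eq0 gM_metric tx); exact: hx.
Qed.

(** The extension has constant coefficients in a local frame of [D1]. *)
Lemma D1_extend p x : U p -> D1 p x ->
  exists A X, [/\ open A, A p, A `<=` U, section_of A D1 X & X p = x].
Proof.
move=> Up; have [A [k [X [[oO Op OU fX] frame]]]] := si_distr J_basis Up.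
rewrite (frame p Op).2 => -[a ->].
exists A, (fun q => \sum_i a i *: X i q); split => //; split.
  apply: (vector_field_sum oO) => i.
  exact: (vector_fieldZ oO (smooth_on_cst _ (a i))).
by move=> q Oq; rewrite (frame q Oq).2; exists a.
Qed.

(** [u1] is the orthogonal projection of [u] onto the span of a local frame of [D1]. *)
Lemma vertical_decomposition p u : U p -> vertical F p u ->
  exists2 u1, D1 p u1 & D2 p (u - u1).
Proof.
move=> Up vu; have [A [k [X [[_ Op _ fX] /(_ p Op)[_ D1E]]]]] := si_distr J_basis Up.
have tX i : tangent p (X i p) by exact: (fX i).1.
have [a ua] := orthogonal_decomposition gM_metric tX vu.1.
exists (\sum_j a j *: X j p); first by rewrite D1E; exists a.
have vu1 : vertical F p (u - \sum_j a j *: X j p).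
  apply: (subspaceB (vertical_subspace F p)) => //.
  by apply: D1_vertical => //; rewrite D1E; exists a.
split => // w; rewrite D1E => -[b ->].
rewrite (metric_sumr gM_metric vu1.1) => [|i].
  by rewrite big1 // => i _; rewrite (metricZr gM_metric _ vu1.1) // ua mulr0.
exact: (subspaceZ (tangent_subspace p)).
Qed.

Lemma lie_bracket_vertical A X Y p : open A -> A p ->
  section_of A (vertical F) X -> section_of A (vertical F) Y ->
  vertical F p (lie_bracket X Y p).
Proof.
move=> oO Op [fX vX] [fY vY]; split.
  exact: (lie_bracket_vector_field nablaM_LC oO fX fY).1.
exact: lie_bracket_tangent_map F_continuous oO Op vX vY.
Qed.

(** Differentiate [g(J_al W, T) = 0]: the contribution of [(nabla_v J_al) W] drops out because every
    [J_be W] is horizontal, and skewness moves [J_al] onto [T]. [X0] is the nonvanishing field that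
    [qk_derivative] asks for. *)
Lemma nabla_D2_J A W T X0 p v al : open A -> A `<=` U -> A p -> tangent p v ->
  section_of A D2 W -> section_of A (vertical F) T ->
  vector_field A X0 -> X0 p != 0 ->
  gM p (nablaM p v W) (J al p (T p)) = gM p (J al p (W p)) (nablaM p v T).
Proof.
move=> oO OU Op tv [fW D2W] [fT vT] fX0 X0p; have Up := OU _ Op.
have fJW := qh_vector_field J_qh al oO OU fW.
have JWT be q : A q -> gM q (J be q (W q)) (T q) = 0.
  by move=> Oq; have [_] := D2_horizontal be (OU _ Oq) (D2W _ Oq); apply; exact: vT.
have tT := fT.1 _ Op; have tW := fW.1 _ Op.
have tnT := connection_tangent nablaM_conn oO Op tv fT.
have tnW := connection_tangent nablaM_conn oO Op tv fW.
have tnJW := connection_tangent nablaM_conn oO Op tv fJW.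
have tJ be u := @qh_tangent _ _ _ _ _ _ _ J_qh be p u Up.
have [c cE] := qk_derivative gM_metric nablaM_LC M_QK J_qh al oO OU Op fX0 X0p fW tv.
have : gM p (nablaM p v (fun q => J al q (W q)) - J al p (nablaM p v W)) (T p) = 0.
  rewrite cE (Defs.metric_sym gM_metric) //.
    rewrite (metric_sumr gM_metric) // => [|be].
      rewrite big1 // => be _; rewrite (metricZr gM_metric) //; last exact: tJ.
      by rewrite (Defs.metric_sym gM_metric) ?JWT ?mulr0 //; exact: tJ.
    by apply: (subspaceZ (tangent_subspace p)); exact: tJ.
  apply: (subspace_sum (tangent_subspace p)) => be.
  by apply: (subspaceZ (tangent_subspace p)); exact: tJ.
rewrite (metricBl gM_metric) //; last exact: tJ.
rewrite (qh_skew gM_metric J_qh al Up tnW tT).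
have := lc_metric nablaM_LC oO Op tv fJW fT.
rewrite (@tangent_cst _ _ _ A p v _ 0) //; last by move=> q /set_mem /JWT.
by move=> E1 E2; lra.
Qed.

Lemma D2_bracket_orthogonal V W p x : section_of U D2 V -> section_of U D2 W ->
  U p -> D1 p x -> gM p (lie_bracket V W p) x = 0.
Proof.
move=> sV sW Up D1x; have [fV D2V] := sV; have [fW D2W] := sW.
have tVW := (lie_bracket_vector_field nablaM_LC U_open fV fW).1 p Up.
have tx := D1_tangent Up D1x.
(* For [x] nonzero, the field [X] below is nonzero at [p] and can also be used as [X0]. *)
have [->|x0] := eqVneq x 0; first exact: metric0r.
(* [x] is put in the form [J_0 X] with [X] in [D1]; the index 0 is an arbitrary choice. *)
have xE : J 0 p (- J 0 p x) = x.
  rewrite (linear_onN (tangent_subspace p) (qh_linear J_qh 0 Up)).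
    by rewrite (qh_sqr J_qh) // opprK.
  exact: (qh_tangent J_qh).
have D1Jx : D1 p (- J 0 p x).
  by apply: (subspaceN (D1_subspace Up)); exact: D1_invariant.
have [A [X [oO Op OU [fX D1X] XpE]]] := D1_extend Up D1Jx.
have Xp0 : X p != 0.
  apply: contra_neq x0 => X0; rewrite -xE -XpE X0.
  exact: linear_on0 (tangent_subspace p) (qh_linear J_qh 0 Up).
have restrict T : section_of U D2 T -> section_of A D2 T.
  by move=> [fT D2T]; split; [exact: vector_field_subset fT|move=> q /OU /D2T].
have vert T : section_of A D2 T -> section_of A (vertical F) T.
  by move=> [fT D2T]; split => // q Oq; apply: D2_vertical; exact: D2T.
have vX : section_of A (vertical F) X.
  by split => // q Oq; apply: D1_vertical; [exact: OU|exact: D1X].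
(* By [nabla_D2_J] the two sides are [g(J_0 T, nabla_S X)] and [g(J_0 T, nabla_X S)]; they differ by
   the pairing of the horizontal [J_0 T] with the vertical [[S, X]]. *)
have key S T : section_of A D2 S -> section_of A D2 T ->
    gM p (nablaM p (S p) T) x = gM p (nablaM p (X p) T) (J 0 p (S p)).
  move=> sS sT; rewrite -xE -XpE.
  have [[fS D2S] [fT D2T]] := (sS, sT).
  rewrite (nabla_D2_J 0 oO OU Op (fS.1 _ Op) sT vX fX Xp0).
  rewrite (nabla_D2_J 0 oO OU Op (fX.1 _ Op) sT (vert _ sS) fX Xp0).
  have [tJT hJT] := D2_horizontal 0 Up (D2T _ Op).
  have tSX := connection_tangent nablaM_conn oO Op (fS.1 _ Op) fX.
  have tXS := connection_tangent nablaM_conn oO Op (fX.1 _ Op) fS.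
  apply/eqP; rewrite -subr_eq0 -(metricBr gM_metric tJT tSX tXS).
  rewrite (lc_torsion_free nablaM_LC oO Op fS fX); apply/eqP/hJT.
  exact: (lie_bracket_vertical oO Op (vert _ sS) vX).
have [sVO sWO] := (restrict _ sV, restrict _ sW).
rewrite -(lc_torsion_free nablaM_LC U_open Up fV fW).
have tVW' := connection_tangent nablaM_conn U_open Up (fV.1 _ Up) fW.
have tWV' := connection_tangent nablaM_conn U_open Up (fW.1 _ Up) fV.
rewrite (metricBl gM_metric) // (key _ _ sVO sWO) (key _ _ sWO sVO).
(* What remains is the symmetry of [g(nabla_X W, J_0 V)] in [V] and [W], obtained from one more use
   of [nabla_D2_J]. *)
rewrite (nabla_D2_J 0 oO OU Op (fX.1 _ Op) sWO (vert _ sVO) fX Xp0).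
rewrite (Defs.metric_sym gM_metric) ?subrr //.
  exact: (D2_horizontal 0 Up (D2W _ Up)).1.
exact: (connection_tangent nablaM_conn U_open Up (fX.1 _ Op) fV).
Qed.

Lemma D2_integrable : integrable_distr U D2.
Proof.
move=> V W sV sW; have [fV D2V] := sV; have [fW D2W] := sW.
split; first exact: (lie_bracket_vector_field nablaM_LC U_open fV fW).
move=> p Up; split; last by move=> x; exact: D2_bracket_orthogonal.
by apply: (lie_bracket_vertical U_open Up); split => // q Uq;
  apply: D2_vertical; [exact: D2V|exact: D2W].
Qed.

(** By [qk_derivative] the vector is a combination of the [J_be Y], which lie in [D1]. The
    nonvanishing field is taken in [D1]; if [D1 p] is zero there is none, but then [Y] vanishes near
    [p]. *)
Lemma nabla_J_D1 Y p v al : section_of U D1 Y -> U p -> tangent p v ->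
  D1 p (nablaM p v (fun q => J al q (Y q)) - J al p (nablaM p v Y)).
Proof.
move=> [fY D1Y] Up tv.
have [[x [D1x x0]]|D1p0] := pselect (exists x, D1 p x /\ x != 0).
  have [A [X [oO Op OU [fX _] XpE]]] := D1_extend Up D1x.
  rewrite -XpE in x0; have fYO := vector_field_subset OU fY.
  have [c ->] := qk_derivative gM_metric nablaM_LC M_QK J_qh al oO OU Op fX x0
    fYO tv.
  apply: (subspace_sum (D1_subspace Up)) => be.
  by apply: (subspaceZ (D1_subspace Up)); apply: D1_invariant => //; exact: D1Y.
have [A [k [X [[oO Op OU fX] frame]]]] := si_distr J_basis Up.
(* A linearly independent frame of the zero space is empty, and its length is the same at all points
   of [A]. *)
have k0 : k = 0%N.
  case: k X fX frame => // k X fX frame; have [free D1E] := frame p Op.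
  suff Xp0 i : X i p = 0.
    (* If the whole frame vanished at [p], the combination with all coefficients 1 would contradict
       independence. *)
    have /(_ _ ord0)/eqP := free (fun=> 1); rewrite oner_eq0; case/(_ _)/notF.
    by rewrite big1 // => i _; rewrite Xp0 scaler0.
  apply: contrapT => /eqP Xi; apply: D1p0; exists (X i p); split => //.
  rewrite D1E; exists (fun j => (j == i)%:R).
  rewrite (bigD1 i) //= eqxx scale1r big1 ?addr0 // => j /negPf ->.
  by rewrite scale0r.
have Y0 : {in A, Y =1 fun=> 0}.
  move=> q /set_mem Oq; have := D1Y q (OU _ Oq); rewrite (frame q Oq).2 => -[a ->].
  by rewrite big1 // => -[i ik] _; have := ik; rewrite [X in (_ < X)%N]k0.
have J0 q : U q -> J al q 0 = 0.
  by move=> Uq; exact: linear_on0 (tangent_subspace q) (qh_linear J_qh al Uq).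
rewrite !(connection0 nablaM_conn oO Op tv) //.
  by rewrite J0 // subr0; exact: (D1_subspace Up).1.
by move=> q qO; rewrite Y0 // J0 //; exact/OU/set_mem.
Qed.

Lemma skew_second_fundamental_form Y Z p al :
  section_of U D1 Y -> section_of U D1 Z -> U p ->
  second_fundamental_form F nablaM nablaF Z (fun q => J al q (Y q)) p
  - second_fundamental_form F nablaM nablaF Y (fun q => J al q (Z q)) p
  = tangent_map F p (J al p (lie_bracket Y Z p)).
Proof.
move=> sY sZ Up; have [[fY D1Y] [fZ D1Z]] := (sY, sZ).
have tY := fY.1 _ Up; have tZ := fZ.1 _ Up.
(* [J al T] is vertical on all of [U], so its push-forward is the zero section there. *)
have push0 T v : section_of U D1 T -> tangent p v ->
    nablaF p v (push_field F (fun q => J al q (T q))) = 0.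
  move=> [_ D1T] tv; apply: (connection0 nablaF_conn U_open Up tv).
  move=> q /set_mem Uq.
  exact: (D1_vertical Uq (D1_invariant al Uq (D1T _ Uq))).2.
(* Moving [J al] out of the covariant derivative costs a vector of [D1], which [F_*] kills. *)
have FJ S T : section_of U D1 S -> section_of U D1 T ->
    tangent_map F p (nablaM p (S p) (fun q => J al q (T q))) =
    tangent_map F p (J al p (nablaM p (S p) T)).
  move=> [fS _] sT; apply/eqP; rewrite -subr_eq0 -tangent_mapB; apply/eqP.
  exact: (D1_vertical Up (nabla_J_D1 al sT Up (fS.1 _ Up))).2.
rewrite /second_fundamental_form !push0 // !FJ // !sub0r opprK addrC.
rewrite -tangent_mapB -(lc_torsion_free nablaM_LC U_open Up fY fZ).
rewrite (linear_onB (tangent_subspace p) (qh_linear J_qh al Up)) //.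
  exact: (connection_tangent nablaM_conn U_open Up tY fZ).
exact: (connection_tangent nablaM_conn U_open Up tZ fY).
Qed.

(** The left side does not involve [al], so the conditions for the three indices become equivalent
    to each other. *)
Lemma D1_integrable_iff al :
  integrable_distr U D1 <-> skew_form_in_mu gM F U (J al) D1 nablaM nablaF.
Proof.
split=> [D1_int Y Z s sY sZ ->|skew Y Z sY sZ].
  have s0 p : U p ->
      second_fundamental_form F nablaM nablaF Z (fun q => J al q (Y q)) p
      - second_fundamental_form F nablaM nablaF Y (fun q => J al q (Z q)) p = 0.
    move=> Up; rewrite skew_second_fundamental_form //.
    apply: (D1_vertical Up (D1_invariant al Up _)).2.
    exact: (D1_int Y Z sY sZ).2.
  split=> [|p Up].
    by apply: eq0_section_along => // p /set_mem; exact: s0.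
  (* The form vanishes identically, so its preimage in [mu] can be 0. *)
  exists 0; last by rewrite s0 // tangent_map0.
  have hJ : J al p @` D2 p `<=` tangent p.
    by move=> _ [u D2u <-]; exact: (D2_horizontal al Up D2u).1.
  apply: (orth_in_subspace gM_metric _ _ hJ).1; last by move=> x [].
  by apply: (orth_in_subspace gM_metric (tangent_subspace p)) => // x [].
have [[fY D1Y] [fZ D1Z]] := (sY, sZ).
split=> [|p Up]; first exact: (lie_bracket_vector_field nablaM_LC U_open fY fZ).
set u := lie_bracket Y Z p.
have vu : vertical F p u.
  by apply: (lie_bracket_vertical U_open Up); split => // q Uq;
    apply: D1_vertical => //; [exact: D1Y|exact: D1Z].
have [u1 D1u1 D2u2] := vertical_decomposition Up vu.
have [tu tu1] := (vu.1, D1_tangent Up D1u1).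
have tu2 := (D2_vertical D2u2).1.
have [_ /(_ p Up)[xi [hxi xi_orth]]] := skew Y Z _ sY sZ erefl.
rewrite skew_second_fundamental_form // -/u => Fxi.
have hJu2 := D2_horizontal al Up D2u2.
(* [xi] and [J_al (u - u1)] are both horizontal, and their images under [F_*] differ by that of
   [J_al u1], which is vertical. *)
have E1 : xi - J al p (u - u1) = 0.
  apply: horizontal_vertical_eq0.
    apply: subspaceB hxi hJu2.
    by apply: (orth_in_subspace gM_metric (tangent_subspace p)) => // x [].
  split; first exact: (subspaceB (tangent_subspace p) hxi.1 hJu2.1).
  rewrite tangent_mapB Fxi -tangent_mapB.
  rewrite (linear_onB (tangent_subspace p) (qh_linear J_qh al Up)) //.
  rewrite opprB addrCA subrr addr0.
  exact: (D1_vertical Up (D1_invariant al Up D1u1)).2.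
(* Being equal to [xi], this vector is orthogonal to [J_al D2], hence to itself. *)
have E2 : J al p (u - u1) = 0.
  apply: (metric_eq0 gM_metric hJu2.1).
  by rewrite -[X in gM p X _](subr0_eq E1); apply: xi_orth; exists (u - u1).
have u2_0 : u - u1 = 0.
  rewrite -[LHS]opprK -(qh_sqr J_qh al Up tu2) E2.
  by rewrite (linear_on0 (tangent_subspace p) (qh_linear J_qh al Up)) oppr0.
by rewrite (subr0_eq u2_0).
Qed.

End SemiInvariantSubmersion.

Theorem lemma3p5 (R : realType) (m n : nat)
  (M : manifold R m) (N : manifold R n)
  (E : M -> set (tvec R M -> tvec R M))
  (gM : M -> tvec R M -> tvec R M -> R)
  (gN : N -> tvec R N -> tvec R N -> R)
  (nablaM : M -> tvec R M -> (M -> tvec R M) -> tvec R M)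
  (nablaN : N -> tvec R N -> (N -> tvec R N) -> tvec R N)
  (nablaM_LC : levi_civita gM nablaM)
  (M_QK : quaternionic_kaehler gM E nablaM)
  (gN_metric : riemannian_metric gN)
  (nablaN_LC : levi_civita gN nablaN)
  (F : M -> N) (lambda : M -> R)
  (nablaF : M -> tvec R M -> (M -> tvec R N) -> tvec R N)
  (nablaF_pullback : pullback_connection F nablaN nablaF)
  (F_submersion : h_conformal_semi_invariant_submersion gM gN F E lambda)
  (U : set M) (J : 'Z_3 -> M -> tvec R M -> tvec R M)
  (D1 : M -> set (tvec R M))
  (J_basis : semi_invariant_basis gM F E U J D1) :
  integrable_distr U (D2_of gM F D1) /\
  [<-> integrable_distr U D1;
       skew_form_in_mu gM F U (J 1) D1 nablaM nablaF;
       skew_form_in_mu gM F U (J 2) D1 nablaM nablaF;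
       skew_form_in_mu gM F U (J 3) D1 nablaM nablaF].
Proof.

have F_continuous : continuous F.
  by case: F_submersion => -[_ [cF _]].
have J_iff al := D1_integrable_iff nablaM_LC M_QK nablaF_pullback.1 F_continuous
  J_basis al.
split; first exact: (D2_integrable nablaM_LC M_QK F_continuous J_basis).
(* Each step of the cycle from (a) through (b), (c), (d) back to (a) goes by way of integrability of
   [D1]. *)
tfae.
- by move/(J_iff 1).
- by move/(J_iff 1)/(J_iff 2).
- by move/(J_iff 2)/(J_iff 3).
- by move/(J_iff 3).
Qed.
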